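(* Let $\lambda\in\mathbb R$. If $\Phi(t)\in\mathcal G_{-\lambda}$ for all $t\in\mathbb R$ and $$\int_{\mathbb R}\|\Phi(t)\|^2_{-\lambda}\,dt<\infty,$$ then for any $\varepsilon>0$ there is a constant $C_\varepsilon$ such that $$\|\delta(\Phi)\|^2_{-\lambda-\varepsilon}\le C_\varepsilon\int_{\mathbb R}\|\Phi(t)\|^2_{-\lambda}\,dt.$$ Thus $\delta(\Phi)\in\mathcal G_{-\lambda-\varepsilon}$ and in particular $\delta(\Phi)\in\mathcal G^*$.
   Context: Let $\mu$ be the Gaussian white noise measure on the space of tempered distributions $\mathcal S'(\mathbb R)$, i.e. $\int e^{i\langle x,\xi\rangle}\,d\mu(x)=e^{-\frac12|\xi|^2_{L^2(\mathbb R)}}$ for $\xi\in\mathcal S(\mathbb R)$, and let $(L^2)=L^2(\mathcal S'(\mathbb R),\mu)$. Every $\phi\in(L^2)$ has a unique chaos expansion $\phi=\sum_{n\ge0}I_n(\phi^{(n)})$ with symmetric $\phi^{(n)}\in L^2(\mathbb R^n)$, where $I_n$ is the $n$-fold iterated Wiener integral. For $\lambda\in\mathbb R$ put $\|\phi\|_\lambda^2=\sum_{n\ge0}n!\,e^{2\lambda n}|\phi^{(n)}|^2_{L^2(\mathbb R^n)}$, and let $\mathcal G_\lambda$ be the space of (for $\lambda<0$: formal) chaos series $\sum_nI_n(\phi^{(n)})$ with symmetric kernels $\phi^{(n)}\in L^2(\mathbb R^n)$ and $\|\phi\|_\lambda<\infty$. $\mathcal G=\bigcap_{\lambda>0}\mathcal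 G_\lambda$ and its dual is $\mathcal G^*=\bigcup_{\lambda>0}\mathcal G_{-\lambda}$. For a $\mathcal G^*$-valued process $\Phi(t)=\sum_{n\ge0}I_n(\Phi^{(n)}(\cdot,t))$ the Skorohod integral is $\delta(\Phi)=\int_{\mathbb R}\Phi(t)\,\delta B(t)=\sum_{n\ge0}I_{n+1}(\widehat\Phi^{(n)})$, where $\widehat\Phi^{(n)}$ is the symmetrization of $\Phi^{(n)}$ in all $n+1$ variables, whenever $\sum_n(n+1)!\,e^{-2(n+1)\lambda'}|\widehat\Phi^{(n)}|^2_{L^2(\mathbb R^{n+1})}<\infty$ for some $\lambda'>0$. *)

(* Defs.v *)
Set Warnings "-redundant-canonical-projection,-notation-overridden,-ambiguous-paths,-notation-incompatible-prefix".
From HB Require Import structures.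
From mathcomp Require Import all_boot all_order all_algebra all_fingroup.
From mathcomp Require Import all_classical all_reals all_analysis.

Set Implicit Arguments.
Unset Strict Implicit.
Unset Printing Implicit Defensive.

Import Order.TTheory GRing.Theory Num.Theory.
Import numFieldNormedType.Exports.

Local Open Scope classical_set_scope.
Local Open Scope ring_scope.

Section lebesgue_tuple.
Context {R : realType}.

(* Tuples over the carrier on which lebesgue_measure is defined; it is R with
   its Borel sets. *)
Local Notation Rn n := (n.-tuple (measurableTypeR R)).

Definition cons_pair n (p : measurableTypeR R * Rn n) : Rn n.+1 :=
  [tuple of p.1 :: p.2].

Lemma measurable_cons_pair n :
  measurable_fun [set: measurableTypeR R * Rn n] (@cons_pair n).
Proof. exact: measurable_cons measurable_fst measurable_snd. Qed.

Lemma behead_cons_pair n (p : measurableTypeR R * Rn n) :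
  [tuple of behead (cons_pair p)] = p.2.
Proof. exact/val_inj. Qed.

Section step.
Variables (n : nat) (m : {sigma_finite_measure set (Rn n) -> \bar R}).

Definition lebesgue_cons : set (Rn n.+1) -> \bar R :=
  pushforward (lebesgue_measure \x m)%E (@cons_pair n).

Let lebesgue_cons0 : lebesgue_cons set0 = 0%E.
Proof. by rewrite /lebesgue_cons /pushforward preimage_set0 measure0. Qed.

Let lebesgue_cons_ge0 A : (0 <= lebesgue_cons A)%E.
Proof. by rewrite /lebesgue_cons /pushforward; exact: measure_ge0. Qed.

Let lebesgue_cons_sigma_additive : semi_sigma_additive lebesgue_cons.
Proof.
move=> F mF tF mUF; rewrite /lebesgue_cons /pushforward preimage_bigcup.
have mc A : measurable A -> measurable (@cons_pair n @^-1` A).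
  by move=> mA; rewrite -[X in measurable X]setTI; exact: measurable_cons_pair.
apply: measure_semi_sigma_additive.
- by move=> i; exact: mc.
- apply/trivIsetP => /= i j _ _ ij; rewrite -preimage_setI.
  by move/trivIsetP : tF => /(_ _ _ _ _ ij) ->//; rewrite preimage_set0.
- by rewrite -preimage_bigcup; exact: mc.
Qed.

HB.instance Definition _ := isMeasure.Build _ _ _ lebesgue_cons
  lebesgue_cons0 lebesgue_cons_ge0 lebesgue_cons_sigma_additive.

Let lebesgue_cons_sigma_finite : sigma_finite setT lebesgue_cons.
Proof.
have /sigma_finiteP[F [TF ndF Foo]] := sigma_finiteT (@lebesgue_measure R).
have /sigma_finiteP[G [TG ndG Goo]] := sigma_finiteT m.
exists (fun k => [set z : Rn n.+1 |
    F k (tnth z ord0) /\ G k [tuple of behead z]]).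
  apply/seteqP; split=> // z _.
  have [i _ Fi] : (\bigcup_i F i) (tnth z ord0) by rewrite -TF.
  have [j _ Gj] : (\bigcup_i G i) [tuple of behead z] by rewrite -TG.
  exists (maxn i j) => //; split.
    by move: Fi; apply/subsetPset/ndF/leq_maxl.
  by move: Gj; apply/subsetPset/ndG/leq_maxr.
move=> k; have [mF Fk] := Foo k; have [mG Gk] := Goo k; split.
  apply: measurableI; rewrite -[X in measurable X]setTI.
    exact: measurable_tnth.
  exact: measurable_behead.
rewrite /lebesgue_cons /pushforward (_ : _ @^-1` _ = F k `*` G k).
  by rewrite product_measure1E// lte_mul_pinfty// ge0_fin_numE.
by apply/seteqP; split=> p; rewrite /= behead_cons_pair.
Qed.

HB.instance Definition _ := Measure_isSigmaFinite.Build _ _ _ lebesgue_cons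
  lebesgue_cons_sigma_finite.

End step.

(* Lebesgue measure on R^n; on R^0 it is the unit mass. *)
Fixpoint lebesgue_tuple n : {sigma_finite_measure set (Rn n) -> \bar R} :=
  if n is n'.+1 then lebesgue_cons (lebesgue_tuple n')
  else \d_([tuple] : Rn 0).

Lemma lebesgue_tuple_box n (A : 'I_n -> set (measurableTypeR R)) :
  (forall i, measurable (A i)) ->
  lebesgue_tuple n [set z | forall i, A i (tnth z i)] =
  (\prod_(i < n) lebesgue_measure (A i))%E.
Proof.
elim: n A => [|n IH] A mA.
  rewrite big_ord0 /= diracE mem_set//= => -[]//.
rewrite big_ord_recl /= -IH //.
rewrite /lebesgue_cons /pushforward.
rewrite (_ : _ @^-1` _ =
  A ord0 `*` [set z : Rn n | forall i, A (lift ord0 i) (tnth z i)]).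
  rewrite product_measure1E //.
  rewrite (_ : [set z | _] = \bigcap_(i in [set: 'I_n])
      ((@tnth n R) ^~ i @^-1` A (lift ord0 i))); last first.
    by apply/seteqP; split=> z /= h i; [move=> _|]; exact: h.
  apply: fin_bigcap_measurable => // i _.
  by rewrite -[X in measurable X]setTI; exact: measurable_tnth.
apply/seteqP; split=> -[x z] /= h.
  split=> [|i]; first exact: (h ord0).
  by have := h (lift ord0 i); rewrite tnthS.
case: h => h0 h i.
by case: (unliftP ord0 i) => [j ->|->]; rewrite ?tnthS//; exact: h.
Qed.

End lebesgue_tuple.

Section chaos.
Context {R : realType}.
Local Notation Rn n := (n.-tuple (measurableTypeR R)).
Implicit Types (n : nat) (l : R).

Definition perm_tuple n (s : 'S_n) (z : Rn n) : Rn n :=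
  [tuple tnth z (s i) | i < n].

Definition ae_symmetric n (f : Rn n -> R) : Prop :=
  forall s : 'S_n, {ae lebesgue_tuple n, forall z, f (perm_tuple s z) = f z}.

Definition symmetrization n (f : Rn n -> R) (z : Rn n) : R :=
  n`!%:R^-1 * \sum_(s : 'S_n) f (perm_tuple s z).

Definition sqr_L2norm n (f : Rn n -> R) : \bar R :=
  ('N[lebesgue_tuple n]_(2%:E)[EFin \o f] ^+ 2)%E.

(* The formal series \sum_n I_n(phi n), given by (representatives of) its
   kernels. *)
Definition chaos : Type := forall n, Rn n -> R.

Definition sqr_chaos_norm l (phi : chaos) : \bar R :=
  (\sum_(0 <= n <oo)
     (n`!%:R * expR (2 * l * n%:R))%:E * sqr_L2norm (phi n))%E.

Definition G_space l : set chaos := [set phi |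
  (forall n, phi n \in Lfun (lebesgue_tuple n) 2%:E /\ ae_symmetric (phi n)) /\
  (sqr_chaos_norm l phi < +oo)%E].

Definition G_dual : set chaos := \bigcup_(l in [set l | 0 < l]) G_space (- l).

Implicit Type Phi : R -> chaos.

(* The time variable is the last of the n.+1 variables. *)
Definition joint_kernel Phi n (z : Rn n.+1) : R :=
  Phi (tnth z ord_max) n [tuple tnth z (widen_ord (leqnSn n) i) | i < n].

(* The kernels of the process are elements of a space of functions of n.+1
   variables: this is what gives a meaning to the L2 norms of their
   symmetrizations. *)
Definition measurable_process Phi : Prop :=
  forall n, measurable_fun [set: Rn n.+1] (@joint_kernel Phi n).

Definition skorohod Phi : chaos := fun n =>
  if n is n'.+1 then symmetrization (@joint_kernel Phi n') else fun=> 0.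

Definition skorohod_integrable Phi : Prop := exists2 l, 0 < l &
  (\sum_(0 <= n <oo)
     ((n.+1)`!%:R * expR (- (2 * n.+1%:R * l)))%:E *
     sqr_L2norm (symmetrization (@joint_kernel Phi n)) < +oo)%E.

End chaos.

(* Main.v *)
Require Import Defs.
Set Warnings "-notation-overridden,-ambiguous-paths,-notation-incompatible-prefix".
From mathcomp Require Import all_boot all_order all_algebra all_fingroup.
From mathcomp Require Import ring.
From mathcomp Require Import all_classical all_reals all_analysis.
From mathcomp Require Import measurable_realfun.

Import Order.TTheory GRing.Theory Num.Theory.

Local Open Scope classical_set_scope.
Local Open Scope ring_scope.

(** The Skorohod integral raises the chaos degree by one: its kernel of degree
    n+1 is the symmetrization of the n-th kernel of the process, the time being
    counted as a variable.  Two facts bound its norm by that of the process.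

    - Symmetrization is a contraction of L^2(R^(n+1))
      ([sqr_L2norm_symmetrization_le]): it is an average over the permutations
      of the variables, squaring is convex, and Lebesgue measure is invariant
      under permutations ([lebesgue_tuple_perm]).
    - By Tonelli's theorem, the squared L^2 norm of the joint kernel is the
      integral over time of the squared norms of the kernels of Phi(t)
      ([sqr_L2norm_joint_kernel]).

    What remains is to compare the weights.  Passing from degree n with
    parameter -lambda to degree n+1 with parameter -lambda-eps multiplies the
    weight by (n+1) e^(-2 lambda) e^(-2 eps (n+1)): the factor n+1 comes from
    the factorial, and it is absorbed by the exponential gained from eps.
    Indeed, y e^(-y) <= 1 at y = 2 eps (n+1) bounds this ratio by
    C = e^(-2 lambda) / (2 eps), for all n ([chaos_weight_shift_le]).  Summing
    over n gives [sqr_chaos_norm_skorohod_le].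

    Membership in the dual space and Skorohod integrability then follow because
    the norms increase with their parameter: -lambda-eps may be lowered to some
    -l with l > 0. *)

Local Notation Rn R n := (n.-tuple (measurableTypeR R)).

(** * Permutation invariance of Lebesgue measure *)

Lemma measurable_perm_tuple (R : realType) n (s : 'S_n) :
  measurable_fun [set: Rn R n] (@perm_tuple R n s).
Proof.
apply/measurable_fun_tnthP => i.
rewrite (_ : _ \o _ = fun z => tnth z (s i)); first exact: measurable_tnth.
by apply/funext => z /=; rewrite tnth_mktuple.
Qed.

Definition box (R : realType) n (A : 'I_n -> set (measurableTypeR R)) :
  set (Rn R n) := [set z | forall i, A i (tnth z i)].

Definition measurable_boxes (R : realType) n : set (set (Rn R n)) :=
  [set box R n A | A in [set A | forall i, measurable (A i)]].

Lemma measurable_box (R : realType) n (A : 'I_n -> set (measurableTypeR R)) :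
  (forall i, measurable (A i)) -> measurable (box R n A).
Proof.
move=> mA; rewrite (_ : box R n A = \bigcap_(i in [set: 'I_n])
    ((fun z : Rn R n => tnth z i) @^-1` A i)).
  apply: fin_bigcap_measurable => // i _.
  by rewrite -[X in measurable X]setTI; exact: measurable_tnth.
by apply/seteqP; split=> z /= h i; [move=> _|]; exact: h.
Qed.

(** The measurable boxes form a pi-system, and they generate the sigma-algebra
    of R^n (next lemma); hence two measures that agree on them, and are finite
    on a sequence of boxes covering R^n, are equal. *)
Lemma setI_closed_measurable_boxes (R : realType) n :
  setI_closed (measurable_boxes R n).
Proof.
move=> _ _ [A mA <-] [B mB <-].
exists (fun i => A i `&` B i) => [i /=|]; first exact: measurableI.
apply/seteqP; split=> z /=; rewrite /box/=.
  by move=> AB; split=> i; have [] := AB i.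
by move=> [hA hB] i; split.
Qed.

Lemma sigma_measurable_boxes (R : realType) n :
  @measurable _ (Rn R n) `<=` <<s measurable_boxes R n >>.
Proof.
apply: smallest_sub; first exact: smallest_sigma_algebra.
rewrite -bigcup_seq => _ [i _ [B mB <-]].
apply: sub_sigma_algebra.
(* A cylinder over one coordinate is a box with all other sides equal to R. *)
exists (fun j => if j == i then B else setT) => [j /=|].
  by case: ifP.
rewrite setTI; apply/seteqP; split=> z /=; rewrite /box /=.
  by move=> /(_ i); rewrite eqxx.
by move=> Bz j; case: eqP => [->|].
Qed.

Lemma perm_tuple_preimage_box (R : realType) n (s : 'S_n) A :
  perm_tuple s @^-1` box R n A = box R n (fun i => A ((s^-1)%g i)).
Proof.
apply/seteqP; split=> z; rewrite /box /= => Az i.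
  by have := Az ((s^-1)%g i); rewrite tnth_mktuple permKV.
by rewrite tnth_mktuple; have := Az (s i); rewrite permK.
Qed.

(** Permuting the variables permutes the sides of a box, hence the factors of
    its volume; uniqueness of measures extends this from boxes to all Borel
    sets. *)
Lemma lebesgue_tuple_perm (R : realType) n (s : 'S_n) (E : set (Rn R n)) :
  measurable E ->
  lebesgue_tuple n (perm_tuple s @^-1` E) = lebesgue_tuple n E.
Proof.
move=> /sigma_measurable_boxes mE; apply: esym.
have /sigma_finiteP[F [TF ndF Foo]] := sigma_finiteT (@lebesgue_measure R).
pose g k := box R n (fun=> F k).
have mF k : measurable (F k) by have [] := Foo k.
have gG k : measurable_boxes R n (g k) by exists (fun=> F k).
apply: (g_sigma_algebra_measure_unique (measurable_boxes R n) _ g gG _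
  (lebesgue_tuple n) (pushforward (lebesgue_tuple n) (perm_tuple s))) => //.
- by move=> _ [A mA <-]; exact: measurable_box.
- apply/seteqP; split=> // z _.
  have /choice[k Fk] (i : 'I_n) : exists k, F k (tnth z i).
    have [k _ Fk] : (\bigcup_i F i) (tnth z i) by rewrite -TF.
    by exists k.
  (* The F k increase, so the cube of the largest index contains z. *)
  exists (\max_(i < n) k i) => // i.
  by move: (Fk i); apply/subsetPset/ndF/leq_bigmax.
- exact: measurable_perm_tuple.
- exact: setI_closed_measurable_boxes.
- move=> ? _ [A mA <-].
  transitivity (lebesgue_tuple n (box R n (fun i => A ((s^-1)%g i)))).
    rewrite [LHS]lebesgue_tuple_box// [RHS]lebesgue_tuple_box//.
    by rewrite [LHS](reindex_inj (@perm_inj _ (s^-1)%g)); apply: eq_bigr.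
  by rewrite -perm_tuple_preimage_box.
- move=> k; rewrite [X in (X < _)%E]lebesgue_tuple_box// ltey_eq.
  rewrite prode_fin_num// => i _.
  by have [_] := Foo k; rewrite ge0_fin_numE.
Qed.

Lemma ge0_integral_perm_tuple (R : realType) n (s : 'S_n)
    (f : Rn R n -> \bar R) :
  measurable_fun [set: Rn R n] f -> (forall z, 0 <= f z)%E ->
  (\int[lebesgue_tuple n]_z f (perm_tuple s z) =
   \int[lebesgue_tuple n]_z f z)%E.
Proof.
move=> mf f0; have ms := measurable_perm_tuple R n s.
rewrite -(@ge0_integral_pushforward _ _ _ _ _ _ ms (lebesgue_tuple n) setT f)//.
by apply: eq_measure_integral => E mE _; exact: lebesgue_tuple_perm.
Qed.

(** * Squared norms of kernels *)

(** The real square is easier to integrate than the square of a norm, which is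
    built from extended real powers. *)
Lemma sqr_L2normE (R : realType) n (f : Rn R n -> R) :
  sqr_L2norm f = (\int[lebesgue_tuple n]_z ((f z) ^+ 2)%:E)%E.
Proof.
have sqE (x : \bar R) : (0 <= x -> x ^+ 2 = x `^ 2)%E.
  case: x => [r||]// r0; last by rewrite poweRyr// expeS expe1 mulyy.
  by rewrite poweR_EFin powR_mulrn.
rewrite /sqr_L2norm sqE ?Lnorm_ge0// poweR_Lnorm//.
apply: eq_integral => z _; rewrite abse_EFin poweR_EFin powR_mulrn//.
by rewrite real_normK// num_real.
Qed.

Lemma sqr_L2norm_ge0 (R : realType) n (f : Rn R n -> R) :
  (0 <= sqr_L2norm f)%E.
Proof. by rewrite sqr_L2normE integral_ge0// => z _; rewrite lee_fin sqr_ge0. Qed.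

Lemma mem_Lfun2 (R : realType) n (f : Rn R n -> R) :
  measurable_fun [set: Rn R n] f ->
  (sqr_L2norm f < +oo)%E -> f \in Lfun (lebesgue_tuple n) 2%:E.
Proof.
move=> mf foo; rewrite inE; apply/andP; split; rewrite inE//=.
rewrite /finite_norm; exact: lte_sqrE.
Qed.

Lemma measurable_symmetrization (R : realType) n (f : Rn R n -> R) :
  measurable_fun [set: Rn R n] f -> measurable_fun setT (symmetrization f).
Proof.
move=> mf; apply: measurable_funM => //; apply: measurable_sum => s.
exact: (measurableT_comp mf (measurable_perm_tuple R n s)).
Qed.

(** The average is over a group, so a translation only reorders its terms. *)
Lemma symmetrization_perm (R : realType) n (f : Rn R n -> R) (s : 'S_n) z :
  symmetrization f (perm_tuple s z) = symmetrization f z.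
Proof.
rewrite /symmetrization; congr (_ * _).
rewrite [RHS](reindex_inj (mulIg s)) /=; apply: eq_bigr => t _; congr f.
by apply: eq_from_tnth => i; rewrite !tnth_mktuple permM.
Qed.

(** The variance, i.e. the sum of the squared deviations from the mean m, is
    nonnegative, and it is the sum of the squares minus #|I| m^2. *)
Lemma sqr_mean_le (R : realType) (I : finType) (a : I -> R) : (0 < #|I|)%N ->
  (#|I|%:R^-1 * \sum_i a i) ^+ 2 <= #|I|%:R^-1 * \sum_i (a i) ^+ 2.
Proof.
move=> I0; have N0 : #|I|%:R != 0 :> R by rewrite pnatr_eq0 -lt0n.
set m := _^-1 * _; set N := #|I|%:R in N0 m *.
have sumE : \sum_i a i = N * m by rewrite mulVKf.
have : 0 <= \sum_i (a i - m) ^+ 2 by apply: sumr_ge0 => i _; exact: sqr_ge0.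
under eq_bigr do rewrite sqrrB.
rewrite big_split/= sumrB sumr_const -/N sumrMnl -mulr_suml sumE.
rewrite (_ : _ + _ = \sum_i (a i) ^+ 2 - N * m ^+ 2); last first.
  by rewrite -mulr_natl -/N; ring.
by rewrite subr_ge0 ler_pdivlMl// lt0r N0 ler0n.
Qed.

Lemma measurable_sqr_EFin (R : realType) n (f : Rn R n -> R) :
  measurable_fun [set: Rn R n] f ->
  measurable_fun [set: Rn R n] (fun z => (f z ^+ 2)%:E).
Proof. by move=> mf; apply/measurable_EFinP; exact: measurable_funX. Qed.

(** Pointwise, the square of the average over permutations is at most the
    average F of the squares; each of the n! terms of F has the integral of f^2,
    because a permutation of the variables preserves the measure. *)
Lemma sqr_L2norm_symmetrization_le (R : realType) n (f : Rn R n -> R) :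
  measurable_fun [set: Rn R n] f ->
  (sqr_L2norm (symmetrization f) <= sqr_L2norm f)%E.
Proof.
move=> mf; rewrite !sqr_L2normE.
have msum : measurable_fun [set: Rn R n]
    (fun z => \sum_(s : 'S_n) ((f (perm_tuple s z)) ^+ 2)%:E)%E.
  apply: emeasurable_sum => s.
  exact: (measurable_sqr_EFin R n (f \o perm_tuple s)
    (measurableT_comp mf (measurable_perm_tuple R n s))).
pose F z := (n`!%:R^-1%:E *
    \sum_(s : 'S_n) ((f (perm_tuple s z)) ^+ 2)%:E)%E.
apply: (@le_trans _ _ (\int[lebesgue_tuple n]_z F z)%E).
  apply: ge0_le_integral => //.
  - by move=> z _; rewrite lee_fin sqr_ge0.
  - exact: (measurable_sqr_EFin R n _ (measurable_symmetrization _ _ _ mf)).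
  - exact: measurable_funeM.
  - move=> z _; rewrite /F sumEFin -EFinM lee_fin -card_Sn.
    rewrite /symmetrization -card_Sn; apply: sqr_mean_le.
    by rewrite card_Sn fact_gt0.
rewrite ge0_integralZl//; last first.
  by move=> z _; apply: sume_ge0 => s _; rewrite lee_fin sqr_ge0.
rewrite ge0_integral_sum//; last 2 first.
- move=> s.
  exact: (measurable_sqr_EFin R n (f \o perm_tuple s)
    (measurableT_comp mf (measurable_perm_tuple R n s))).
- by move=> s z _; rewrite lee_fin sqr_ge0.
under eq_bigr => s _ do rewrite
  (ge0_integral_perm_tuple _ _ s (fun z => (f z ^+ 2)%:E)
    (measurable_sqr_EFin R n _ mf) (fun z => sqr_ge0 (f z))).
rewrite big_const card_Sn iter_addr addr0 -[X in (_ * X)%E]mule_natl.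
by rewrite muleA -EFinM mulVf ?mul1e.
Qed.

(** * The process as one function of space and time *)

(** Lebesgue measure on R^(n+1) is built by adding variables in front, while
    time is the last variable of the joint kernel.  This permutation moves time
    to the front and keeps the order of the other variables. *)
Definition time_first_perm n : 'S_n.+1 := lift_perm ord_max ord0 1%g.

Lemma joint_kernel_time_first (R : realType) (Phi : R -> @chaos R) n t
    (z : Rn R n) :
  joint_kernel Phi (perm_tuple (time_first_perm n) (cons_pair (t, z))) =
  Phi t n z.
Proof.
rewrite /joint_kernel tnth_mktuple lift_perm_id; congr (Phi _ _ _).
apply: eq_from_tnth => i; rewrite !tnth_mktuple.
rewrite (_ : widen_ord _ i = lift ord_max i); last first.
  by apply/val_inj; rewrite /= -[LHS](lift_max i).
by rewrite lift_perm_lift perm1 tnthS; congr (tnth _ i); exact/val_inj.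
Qed.

(** Tonelli's theorem, applied to the squared kernel as a function of the time
    and the remaining variables, gives both the measurability of the squared
    norm in time and its integral. *)
Section tonelli.
Variables (R : realType) (Phi : R -> @chaos R) (n : nat).
Hypothesis mPhi : measurable_fun [set: Rn R n.+1] (@joint_kernel R Phi n).

Let F (p : measurableTypeR R * Rn R n) : \bar R := ((Phi p.1 n p.2) ^+ 2)%:E.

Let F_ge0 p : (0 <= F p)%E.
Proof. by rewrite lee_fin sqr_ge0. Qed.

Let mF : measurable_fun [set: measurableTypeR R * Rn R n] F.
Proof.
have -> : F = (fun z => ((joint_kernel Phi z) ^+ 2)%:E) \o
    (perm_tuple (time_first_perm n) \o @cons_pair R n).
  by apply/funext => -[t z] /=; rewrite joint_kernel_time_first.
apply: (measurableT_comp (measurable_sqr_EFin R n.+1 _ mPhi)).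
exact: (measurableT_comp (measurable_perm_tuple R n.+1 _)
  (@measurable_cons_pair R n)).
Qed.

Lemma measurable_sqr_L2norm_kernel :
  measurable_fun [set: measurableTypeR R] (fun t => sqr_L2norm (Phi t n)).
Proof.
rewrite (_ : (fun _ => _) = fubini_F (lebesgue_tuple n) F).
  exact: measurable_fun_fubini_tonelli_F.
by apply/funext => t; rewrite sqr_L2normE.
Qed.

Lemma sqr_L2norm_joint_kernel :
  sqr_L2norm (@joint_kernel R Phi n) =
  (\int[lebesgue_measure]_t sqr_L2norm (Phi t n))%E.
Proof.
(* With time in front, the measure is the image of the product of Lebesgue
   measure in time and in the remaining variables. *)
rewrite sqr_L2normE -(ge0_integral_perm_tuple R n.+1 (time_first_perm n)
  (fun z => ((joint_kernel Phi z) ^+ 2)%:E)); last 2 first.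
- exact: measurable_sqr_EFin.
- by move=> z; rewrite lee_fin sqr_ge0.
rewrite [LHS](@ge0_integral_pushforward _ _ _ _ _ _
  (@measurable_cons_pair R n) (lebesgue_measure \x lebesgue_tuple n)%E setT
  (fun z => ((joint_kernel Phi (perm_tuple (time_first_perm n) z)) ^+ 2)%:E))//.
- transitivity (\int[lebesgue_measure \x lebesgue_tuple n]_p F p)%E.
    rewrite preimage_setT; apply: eq_integral => -[t z] _ /=.
    by rewrite joint_kernel_time_first.
  rewrite fubini_tonelli1//; apply: eq_integral => t _.
  by rewrite sqr_L2normE.
- exact: (measurableT_comp (measurable_sqr_EFin R n.+1 _ mPhi)
    (measurable_perm_tuple R n.+1 _)).
- by move=> z _; rewrite lee_fin sqr_ge0.
Qed.

End tonelli.

(** * Weighted chaos norms *)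

Lemma chaos_term_ge0 (R : realType) n (x : R) m (f : Rn R m -> R) :
  (0 <= (n`!%:R * expR x)%:E * sqr_L2norm f)%E.
Proof. by rewrite mule_ge0 ?sqr_L2norm_ge0// lee_fin mulr_ge0// expR_ge0. Qed.

Lemma le_sqr_chaos_norm (R : realType) (l l' : R) (phi : @chaos R) :
  l <= l' -> (sqr_chaos_norm l phi <= sqr_chaos_norm l' phi)%E.
Proof.
move=> ll'; apply: lee_nneseries => n *; first exact: chaos_term_ge0.
apply: lee_wpmul2r; first exact: sqr_L2norm_ge0.
by rewrite lee_fin ler_wpM2l// ler_expR ler_wpM2r// ler_wpM2l.
Qed.

Lemma G_space_antimono (R : realType) (l l' : R) :
  l <= l' -> @G_space R l' `<=` G_space l.
Proof.
move=> ll' phi [hphi phioo]; split=> //; apply: le_lt_trans phioo.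
exact: le_sqr_chaos_norm.
Qed.

(** One term of the series is a positive multiple of this squared norm. *)
Lemma sqr_L2norm_lty_chaos (R : realType) (l : R) (phi : @chaos R) n :
  (sqr_chaos_norm l phi < +oo)%E -> (sqr_L2norm (phi n) < +oo)%E.
Proof.
move=> phioo; have w0 : 0 < n`!%:R * expR (2 * l * n%:R) :> R.
  by rewrite mulr_gt0 ?expR_gt0// ltr0n fact_gt0.
have : ((n`!%:R * expR (2 * l * n%:R))%:E * sqr_L2norm (phi n) < +oo)%E.
  apply: le_lt_trans phioo.
  apply: le_trans (nneseries_lim_ge n.+1 _).
    by rewrite big_nat_recr//= leeDr// sume_ge0// => k _; exact: chaos_term_ge0.
  by move=> *; exact: chaos_term_ge0.
have := sqr_L2norm_ge0 _ _ (phi n).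
by case: (sqr_L2norm (phi n)) => [r|//|//] _; rewrite ?ltry// gt0_muley ?lte_fin.
Qed.

(** The term of degree 0 vanishes: a Skorohod integral has zero mean. *)
Lemma sqr_chaos_norm_skorohod (R : realType) (l : R) (Phi : R -> @chaos R) :
  sqr_chaos_norm l (skorohod Phi) =
  (\sum_(0 <= n <oo) ((n.+1)`!%:R * expR (2 * l * n.+1%:R))%:E *
     sqr_L2norm (symmetrization (@joint_kernel R Phi n)))%E.
Proof.
rewrite /sqr_chaos_norm nneseries_recl//; last first.
  by move=> *; exact: chaos_term_ge0.
rewrite [X in (X + _)%E](_ : _ = 0)%E ?add0e; last first.
  rewrite sqr_L2normE (eq_integral (cst 0%E)) ?integral0 ?mule0// => z _ /=.
  by rewrite expr0n.
rewrite -nneseries_addn; last by move=> *; exact: chaos_term_ge0.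
by apply: eq_eseriesr => n _; rewrite addn1.
Qed.

Lemma integral_sqr_chaos_norm (R : realType) (l : R) (Phi : R -> @chaos R) :
  measurable_process Phi ->
  (\int[lebesgue_measure]_t sqr_chaos_norm l (Phi t) =
   \sum_(0 <= n <oo) (n`!%:R * expR (2 * l * n%:R))%:E *
     sqr_L2norm (@joint_kernel R Phi n))%E.
Proof.
move=> mPhi; rewrite integral_nneseries//; last 2 first.
- move=> n; apply: measurable_funeM.
  exact: (measurable_sqr_L2norm_kernel _ _ _ (mPhi n)).
- by move=> n t _; exact: chaos_term_ge0.
apply: eq_eseriesr => n _; rewrite ge0_integralZl//; last 2 first.
- exact: (measurable_sqr_L2norm_kernel _ _ _ (mPhi n)).
- by move=> t _; exact: sqr_L2norm_ge0.
by rewrite sqr_L2norm_joint_kernel.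
Qed.

(** The loss eps in the exponent pays for the factor n+1 of the factorial: with
    y = 2 eps (n+1), the ratio of the two weights is
    e^(-2 lambda) y e^(-y) / (2 eps), and y <= e^y. *)
Lemma chaos_weight_shift_le (R : realType) (lambda eps : R) n : 0 < eps ->
  (n.+1)`!%:R * expR (2 * (- lambda - eps) * n.+1%:R) <=
  expR (- (2 * lambda)) / (2 * eps) *
    (n`!%:R * expR (2 * - lambda * n%:R)).
Proof.
move=> eps0; set y := 2 * eps * n.+1%:R.
have -> : 2 * (- lambda - eps) * n.+1%:R =
    - (2 * lambda) + 2 * - lambda * n%:R - y by rewrite /y -natr1; ring.
have yexp : y * expR (- y) <= 1.
  rewrite expRN ler_pdivrMr ?expR_gt0// mul1r.
  by apply: le_trans (expR_ge1Dx y); rewrite lerDr.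
rewrite !expRD factS natrM.
rewrite [leRHS](_ : _ = n`!%:R * (expR (- (2 * lambda)) *
  expR (2 * - lambda * n%:R)) / (2 * eps)); last by ring.
rewrite ler_pdivlMr ?mulr_gt0//.
rewrite [leLHS](_ : _ = n`!%:R * (expR (- (2 * lambda)) *
  expR (2 * - lambda * n%:R)) * (y * expR (- y))); last by rewrite /y; ring.
by apply: ler_piMr => //; rewrite !mulr_ge0// expR_ge0.
Qed.

Lemma sqr_chaos_norm_skorohod_le (R : realType) (lambda eps : R)
    (Phi : R -> @chaos R) : 0 < eps -> measurable_process Phi ->
  (sqr_chaos_norm (- lambda - eps) (skorohod Phi) <=
   (expR (- (2 * lambda)) / (2 * eps))%:E *
     \int[lebesgue_measure]_t sqr_chaos_norm (- lambda) (Phi t))%E.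
Proof.
move=> eps0 mPhi; rewrite sqr_chaos_norm_skorohod integral_sqr_chaos_norm//.
rewrite -nneseriesZl; last by move=> *; exact: chaos_term_ge0.
apply: lee_nneseries => n *; first exact: chaos_term_ge0.
rewrite [X in (_ <= X)%E]muleA -EFinM; apply: lee_pmul.
- by rewrite lee_fin mulr_ge0// expR_ge0.
- exact: sqr_L2norm_ge0.
- by rewrite lee_fin chaos_weight_shift_le.
- exact: sqr_L2norm_symmetrization_le.
Qed.

Lemma G_space_skorohod (R : realType) (l : R) (Phi : R -> @chaos R) :
  measurable_process Phi -> (sqr_chaos_norm l (skorohod Phi) < +oo)%E ->
  G_space l (skorohod Phi).
Proof.
move=> mPhi foo; split=> // n; split.
  apply: mem_Lfun2; last exact: sqr_L2norm_lty_chaos foo.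
  by case: n => [|n] /=; [exact: measurable_cst|exact: measurable_symmetrization].
move=> s; apply: aeW => z; case: n s z => [//|n] s z.
exact: symmetrization_perm.
Qed.

Theorem theorem3p10 (R : realType) (lambda eps : R) (heps : 0 < eps) :
  exists C : R, forall Phi : R -> @chaos R,
    measurable_process Phi ->
    (forall t : R, G_space (- lambda) (Phi t)) ->
    (\int[lebesgue_measure]_t sqr_chaos_norm (- lambda) (Phi t) < +oo)%E ->
    [/\ skorohod_integrable Phi,
        (sqr_chaos_norm (- lambda - eps) (skorohod Phi) <=
         C%:E * \int[lebesgue_measure]_t sqr_chaos_norm (- lambda) (Phi t))%E,
        G_space (- lambda - eps) (skorohod Phi) &
        G_dual (skorohod Phi)].
Proof.
exists (expR (- (2 * lambda)) / (2 * eps)) => Phi mPhi _ Phioo.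
have bound := sqr_chaos_norm_skorohod_le R lambda eps Phi heps mPhi.
have deltaoo : (sqr_chaos_norm (- lambda - eps) (skorohod Phi) < +oo)%E.
  apply: le_lt_trans bound _; apply: lte_mul_pinfty => //.
    by rewrite lee_fin divr_ge0 ?expR_ge0// mulr_ge0// ltW.
have deltaG := G_space_skorohod R _ Phi mPhi deltaoo.
(* Both the dual space and integrability require a positive parameter, whereas
   lambda + eps may be negative; enlarging it only decreases the norm. *)
pose l := Num.max 1 (lambda + eps).
have l0 : 0 < l by rewrite lt_max ltr01.
have Gl : G_space (- l) (skorohod Phi).
  by apply: G_space_antimono deltaG; rewrite -opprD lerN2 le_max lexx orbT.
split=> //; last by exists l.
exists l => //; have [_] := Gl.
rewrite sqr_chaos_norm_skorohod; congr (_ < _)%E.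
apply: eq_eseriesr => n _; congr (((_ * expR _)%:E * _)%E).
by rewrite mulrN mulNr mulrAC.
Qed.
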